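(* Suppose $k\ge3$ and $d(d+1)\le2^{k+1}-4$. Suppose $w_i\in[a,b]$, $i=1,\dots,2^k$, where $0<a<b$ (so the region of weight vectors is $\mathcal W=[a,b]^{2^k}$). Let $\mathbf I=\{i_1,\dots,i_{d+1}\}$ be an index set which maximizes $|X[i_1,i_2,\dots,i_{d+1}]|^2$ among all sets of $d+1$ distinct indices in $\{1,\dots,2^k\}$. Then the design $\mathbf p_I=(p_1,\dots,p_{2^k})'$ satisfying $p_{i_1}=\cdots=p_{i_{d+1}}=\frac1{d+1}$ (and $p_i=0$ for $i\notin\mathbf I$) is a most robust minimally supported design, with maximum loss of efficiency $1-\frac ab$ compared to other minimally supported designs.
   Context: Setting: $k$ factors at two levels $\pm1$. The $2^k$ experimental conditions are the elements of $\{-1,1\}^k$, listed in some order. The model matrix $X$ is a $2^k\times(d+1)$ matrix with entries $\pm1$, $d\ge k$, whose $i$th row corresponds to the $i$th experimental condition $(x_1,\dots,x_k)$. Its first column is all ones (intercept); the other $d$ columns are distinct and consist of the $k$ main effects $x_1,\dots,x_k$ and, possibly, some interactions (products $\prod_{j\in S}x_j$ with $S\subseteq\{1,\dots,k\}$, $|S|\ge2$). $X[i_1,\dots,i_{d+1}]$ denotes the $(d+1)\times(d+1)$ submatrix of $X$ formed by rows $i_1,\dots,i_{d+1}$, and $|\cdot|$ is the determinant. A design is $\mathbf p=(p_1,\dots,p_{2^k})'$ with $p_i\ge0$ and $\sum_i p_i=1$; it is minimally supported if it has exactly $d+1$ nonzero $p_i$'s. For a weight vector $\mathbf w=(w_1,\dots,w_{2^k})'$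 put $\psi(\mathbf p,\mathbf w)=|X'WX|$ with $W=\mathrm{diag}\{w_1p_1,\dots,w_{2^k}p_{2^k}\}$. The loss of efficiency of a minimally supported design $\mathbf p$ given $\mathbf w$, compared to minimally supported designs, is $$R(\mathbf p,\mathbf w)=1-\left(\frac{\psi(\mathbf p,\mathbf w)}{\psi(\mathbf p_w,\mathbf w)}\right)^{\frac1{d+1}},$$ where $\mathbf p_w$ is a design maximizing $\psi(\cdot,\mathbf w)$ over all minimally supported designs. The maximum loss of efficiency over $\mathcal W$ is $R_{\max}(\mathbf p)=\max_{\mathbf w\in\mathcal W}R(\mathbf p,\mathbf w)$. A most robust minimally supported design is one that minimizes $R_{\max}$ among all minimally supported designs. *)

(* Defs.v *)
From HB Require Import structures.
From mathcomp Require Import all_boot all_order all_algebra.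
From mathcomp Require Import all_classical all_reals all_analysis.

Set Implicit Arguments.
Unset Strict Implicit.
Unset Printing Implicit Defensive.

Import Order.TTheory GRing.Theory Num.Theory.
Local Open Scope ring_scope.

(* The rows of D list the elements of {-1,1}^k, each exactly once, in some
   order. *)
Definition full_factorial (R : realType) (k : nat) (D : 'M[R]_(2 ^ k, k)) :
    Prop :=
  (forall i l, D i l = 1 \/ D i l = -1) /\
  (forall v : 'rV[R]_k, (forall l, v ord0 l = 1 \/ v ord0 l = -1) ->
     exists! i, row i D = v).

(* S j is the set of factors multiplied in column j + 1: a singleton for a main
   effect, a larger set for an interaction.  Injectivity of S is the
   distinctness of the columns. *)
Definition model_matrix (R : realType) (k d : nat) (D : 'M[R]_(2 ^ k, k))
    (X : 'M[R]_(2 ^ k, d.+1)) : Prop :=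
  exists S : 'I_d -> {set 'I_k},
    [/\ injective S,
        (forall j, S j != finset.set0),
        (forall l, exists j, S j = [set l]%SET),
        (forall i, X i ord0 = 1) &
        (forall i j, X i (lift ord0 j) = \prod_(l in S j) D i l)].

Definition psi (R : realType) (n d : nat) (X : 'M[R]_(n, d.+1))
    (p w : 'cV[R]_n) : R :=
  \det (X^T *m diag_mx (\row_i (w i ord0 * p i ord0)) *m X).

Definition design (R : realType) (n : nat) (p : 'cV[R]_n) : Prop :=
  (forall i, 0 <= p i ord0) /\ \sum_i p i ord0 = 1.

Definition min_supported (R : realType) (n : nat) (d : nat) (p : 'cV[R]_n) :
    Prop :=
  design p /\ #|[pred i | p i ord0 != 0]| = d.+1.

Definition maximizes_psi (R : realType) (n d : nat) (X : 'M[R]_(n, d.+1))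
    (w p : 'cV[R]_n) : Prop :=
  min_supported d p /\
  forall q : 'cV[R]_n, min_supported d q -> psi X q w <= psi X p w.

(* A chosen maximizer.  The loss below does not depend on the choice; if there
   were no maximizer, the default 0 would make psi X (popt X w) w vanish and the
   loss equal to 1. *)
Definition popt (R : realType) (n d : nat) (X : 'M[R]_(n, d.+1))
    (w : 'cV[R]_n) : 'cV[R]_n :=
  xget 0 [set p | maximizes_psi X w p]%classic.

Definition loss (R : realType) (n d : nat) (X : 'M[R]_(n, d.+1))
    (p w : 'cV[R]_n) : R :=
  1 - (psi X p w / psi X (popt X w) w) `^ (d.+1%:R^-1).

Definition weight_box (R : realType) (n : nat) (a b : R) : set 'cV[R]_n :=
  [set w | forall i, a <= w i ord0 <= b]%classic.

(* r is the maximum, attained, of the loss of p over W. *)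
Definition is_max_loss (R : realType) (n d : nat) (X : 'M[R]_(n, d.+1))
    (W : set 'cV[R]_n) (p : 'cV[R]_n) (r : R) : Prop :=
  (exists2 w, W w & loss X p w = r) /\ (forall w, W w -> loss X p w <= r).

(* The maximum is required to exist for every competitor q as well. *)
Definition most_robust (R : realType) (n d : nat) (X : 'M[R]_(n, d.+1))
    (W : set 'cV[R]_n) (p : 'cV[R]_n) : Prop :=
  min_supported d p /\
  exists2 r, is_max_loss X W p r &
    forall q : 'cV[R]_n, min_supported d q ->
      exists2 s, is_max_loss X W q s & r <= s.

(* An index set {i_1, ..., i_{d+1}} is given by an injective enumeration f; the
   squared minor does not depend on the enumeration. *)
Definition max_minor (R : realType) (n d : nat) (X : 'M[R]_(n, d.+1))
    (f : 'I_d.+1 -> 'I_n) : Prop :=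
  injective f /\
  forall g : 'I_d.+1 -> 'I_n, injective g ->
    \det (rowsub g X) ^+ 2 <= \det (rowsub f X) ^+ 2.

Definition uniform_design (R : realType) (n d : nat) (f : 'I_d.+1 -> 'I_n) :
    'cV[R]_n :=
  \col_i (if i \in codom f then d.+1%:R^-1 else 0).

(* Main.v *)
Require Import Defs.
From HB Require Import structures.
From mathcomp Require Import all_boot all_order all_algebra.
From mathcomp Require Import all_classical all_reals all_analysis.
From mathcomp Require Import zify lra.

Set Implicit Arguments.
Unset Strict Implicit.
Unset Printing Implicit Defensive.

Import Order.TTheory GRing.Theory Num.Theory.
Local Open Scope ring_scope.

(** On a support [g] of [d + 1] rows, [psi] is the squared minor of [g] times the
    product of the [w i * p i] over [g] ([psi_support]), so uniform weights are
    best on each support ([psi_le_uniform]) and an optimal design exists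
    ([popt_maximizes]).

    For a design [q] supported on [g], the weights equal to [a] on [g] and to [b]
    elsewhere are the worst ones in the box, whatever the support of the competing
    design ([max_loss_adverse]): this identifies the maximum loss of [q], and
    shows that it is attained, without an appeal to compactness. If some support
    disjoint from [g] has a squared minor at least that of [g], the loss at these
    weights is at least [1 - a / b], since each of the [d + 1] support points then
    costs a factor [a / b] ([loss_adverse_ge]). Conversely the uniform design on a
    support of maximal minor never loses more than [1 - a / b], because no
    competitor has a larger minor and the weights vary by a factor of at most
    [b / a] ([loss_uniform_le]). Hence all that is needed is, for every support,
    a disjoint one with the same squared minor.

    The experimental conditions form the group [{-1, 1}^k] and the columns of [X]
    are characters of it. Translating the rows of a submatrix multiplies its
    columns by signs and preserves the squared minor ([minor_translation]). A
    translation that makes a support meet its image must be a difference of two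
    of its points; as the group has exponent two, a difference does not depend
    on the order of the points, so there are at most
    [d * (d + 1) / 2 + 1 <= 2 ^ k - 1] of them, counting the trivial one, and
    some translation is left over ([disjoint_translate]). Orthogonality of
    characters makes the maximal minor nonzero ([max_minor_neq0]), so that the
    denominator of the loss is positive. *)

(** * Minimally supported designs *)

Lemma big_codom_inj (T : Type) (idx : T) (op : Monoid.com_law idx)
    (I J : finType) (g : I -> J) (F : J -> T) :
  injective g ->
  \big[op/idx]_(j in codom g) F j = \big[op/idx]_i F (g i).
Proof.
move=> g_inj; rewrite -[RHS]big_image /=.
by rewrite big_uniq //; apply/injectiveP.
Qed.

(** The rows outside the support contribute nothing to the information matrix,
    which is therefore the product of three square matrices. *)
Lemma psi_support (R : realType) (n d : nat) (X : 'M[R]_(n, d.+1))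
    (p w : 'cV[R]_n) (g : 'I_d.+1 -> 'I_n) :
  injective g -> (forall i, i \notin codom g -> p i ord0 = 0) ->
  psi X p w = \det (rowsub g X) ^+ 2 *
              \prod_k (w (g k) ord0 * p (g k) ord0).
Proof.
move=> g_inj p0; rewrite /psi.
pose e := \row_k (w (g k) ord0 * p (g k) ord0).
have -> : X^T *m diag_mx (\row_i (w i ord0 * p i ord0)) *m X =
    (rowsub g X)^T *m diag_mx e *m rowsub g X.
  apply/matrixP => u v; rewrite !mxE.
  pose G i := X i u * (w i ord0 * p i ord0) * X i v.
  transitivity (\sum_(i in codom g) G i).
    rewrite [RHS]big_mkcond; apply: eq_bigr => i _; rewrite mul_mx_diag !mxE.
    by case: ifPn => // /p0 ->; rewrite mulr0 mulr0 mul0r.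
  by rewrite big_codom_inj //; apply: eq_bigr => k _; rewrite mul_mx_diag !mxE.
rewrite !det_mulmx det_tr det_diag expr2 mulrAC; congr (_ * _).
by apply: eq_bigr => k _; rewrite mxE.
Qed.

Lemma min_supported_enum (R : realType) (n d : nat) (p : 'cV[R]_n) :
  min_supported d p ->
  exists2 g : 'I_d.+1 -> 'I_n, injective g &
    forall i, (i \in codom g) = (p i ord0 != 0).
Proof.
case=> _ card_p.
exists (fun k => enum_val (cast_ord (esym card_p) k)).
  by move=> x y /enum_val_inj /(congr1 val) /= /val_inj.
move=> i; apply/codomP/idP => [[k ->]|pi].
  by have := enum_valP (cast_ord (esym card_p) k).
have pi' : i \in [pred i | p i ord0 != 0] by [].
exists (cast_ord card_p (enum_rank_in pi' i)).
by rewrite cast_ordK enum_rankK_in.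
Qed.

Lemma uniform_min_supported (R : realType) (n d : nat)
    (g : 'I_d.+1 -> 'I_n) :
  injective g -> min_supported d (uniform_design R g).
Proof.
move=> g_inj; split; first split.
- by move=> i; rewrite mxE; case: ifP; rewrite // invr_ge0 ler0n.
- under eq_bigr do rewrite mxE.
  rewrite -big_mkcond big_codom_inj // sumr_const card_ord.
  by rewrite -[_ *+ _]mulr_natr mulVf // pnatr_eq0.
- rewrite -[RHS](card_ord d.+1) -(card_codom g_inj).
  apply: eq_card => i; rewrite inE mxE.
  by case: ifP => // _; rewrite ?eqxx // invr_eq0 pnatr_eq0.
Qed.

Lemma psi_uniform (R : realType) (n d : nat) (X : 'M[R]_(n, d.+1))
    (g : 'I_d.+1 -> 'I_n) (w : 'cV[R]_n) :
  injective g ->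
  psi X (uniform_design R g) w =
    \det (rowsub g X) ^+ 2 * (\prod_k w (g k) ord0) * d.+1%:R^-1 ^+ d.+1.
Proof.
move=> g_inj; rewrite (psi_support _ _ g_inj); last first.
  by move=> i /negbTE gi; rewrite mxE gi.
rewrite -mulrA; congr (_ * _); rewrite big_split /=; congr (_ * _).
under eq_bigr do rewrite mxE codom_f.
by rewrite prodr_const card_ord.
Qed.

(** On a fixed support [psi] is proportional to the product of the design
    weights, whose sum is 1, so the inequality of arithmetic and geometric means
    singles out the uniform weights. *)
Lemma psi_le_uniform (R : realType) (n d : nat) (X : 'M[R]_(n, d.+1))
    (p w : 'cV[R]_n) (g : 'I_d.+1 -> 'I_n) :
  injective g -> design p -> (forall i, i \notin codom g -> p i ord0 = 0) ->
  (forall i, 0 <= w i ord0) ->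
  psi X p w <= psi X (uniform_design R g) w.
Proof.
move=> g_inj [p_ge0 p_sum] p0 w_ge0.
rewrite psi_uniform // (psi_support _ _ g_inj p0) big_split /= mulrA.
apply: ler_wpM2l.
  by rewrite mulr_ge0 ?sqr_ge0 ?prodr_ge0.
have /leif_AGM [+ _] : {in 'I_d.+1, forall k, 0 <= p (g k) ord0} by [].
rewrite card_ord.
suff -> : \sum_k p (g k) ord0 = 1 by rewrite div1r.
rewrite -(big_codom_inj _ (fun i => p i ord0)) // big_mkcond -[RHS]p_sum.
by apply: eq_bigr => i _; case: ifPn => // /p0.
Qed.

(** By [psi_le_uniform] only the uniform designs compete, and there are finitely
    many of them. *)
Lemma popt_maximizes (R : realType) (n d : nat) (X : 'M[R]_(n, d.+1))
    (f : 'I_d.+1 -> 'I_n) (w : 'cV[R]_n) :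
  injective f -> (forall i, 0 <= w i ord0) -> maximizes_psi X w (popt X w).
Proof.
move=> f_inj w_ge0; apply: xgetPex.
pose F (g : {ffun 'I_d.+1 -> 'I_n}) := psi X (uniform_design R g) w.
have f0 : injectiveb (finfun f) by apply/injectiveP => x y; rewrite !ffunE => /f_inj.
case: (@Order.TotalTheory.arg_maxP _ _ _ (finfun f) (fun g => injectiveb g) F f0).
move=> h /injectiveP h_inj h_max; exists (uniform_design R h).
split; first exact: uniform_min_supported.
move=> q q_ms; have [g g_inj gq] := min_supported_enum q_ms.
have eq_g : g = finfun g :> (_ -> _) by apply/funext => x; rewrite ffunE.
apply: (@le_trans _ _ (psi X (uniform_design R g) w)).
  apply: psi_le_uniform => //; first by case: q_ms.
  by move=> i; rewrite gq negbK => /eqP.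
rewrite eq_g; apply: h_max.
by apply/injectiveP; rewrite -eq_g.
Qed.

(** * The least favourable weights *)

Definition adverse_weight (R : realType) (n d : nat) (a b : R)
    (g : 'I_d.+1 -> 'I_n) : 'cV[R]_n :=
  \col_i (if i \in codom g then a else b).

Lemma adverse_weight_box (R : realType) (n d : nat) (a b : R)
    (g : 'I_d.+1 -> 'I_n) :
  a <= b -> weight_box a b (adverse_weight a b g).
Proof. by move=> ab i; rewrite mxE; case: ifP; rewrite lexx ab. Qed.

(** Factors common to both products cancel; what is left compares [a] with a
    weight on the first support and a weight on the second support with [b]. *)
Lemma adverse_weight_prod (R : realType) (n d : nat) (a b : R)
    (g h : 'I_d.+1 -> 'I_n) (w : 'cV[R]_n) :
  0 <= a -> injective g -> injective h -> weight_box a b w ->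
  (\prod_k adverse_weight a b g (g k) ord0) * (\prod_k w (h k) ord0) <=
  (\prod_k w (g k) ord0) * (\prod_k adverse_weight a b g (h k) ord0).
Proof.
move=> a0 g_inj h_inj wab.
have w0 i : 0 <= w i ord0 by have /andP[+ _] := wab i; apply: le_trans.
have b0 : 0 <= b by have /andP[_] := wab (g ord0); apply: le_trans.
rewrite -!(big_codom_inj _ (fun i => w i ord0)) //.
rewrite -!(big_codom_inj _ (fun i => adverse_weight a b g i ord0)) //.
rewrite !(big_mkcond (fun i => i \in codom _)) /= -!big_split /=.
apply: ler_prod => i _; rewrite mxE.
have /andP[aw wb] := wab i; have wi := w0 i.
case: (i \in codom g); case: (i \in codom h); rewrite ?mulr1 ?mul1r.
- by rewrite mulr_ge0 // mulrC lexx.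
- by rewrite a0.
- by rewrite wi.
- by rewrite ler01 lexx.
Qed.

Lemma loss_le_cross (R : realType) (n d : nat) (X : 'M[R]_(n, d.+1))
    (p w v : 'cV[R]_n) :
  0 <= psi X p v -> 0 < psi X (popt X v) v -> 0 < psi X (popt X w) w ->
  psi X p v * psi X (popt X w) w <= psi X p w * psi X (popt X v) v ->
  loss X p w <= loss X p v.
Proof.
rewrite /loss.
move: (psi X p v) (psi X (popt X v) v) (psi X p w) (psi X (popt X w) w).
move=> xv mv xw mw pv Mv Mw H; rewrite lerD2l lerN2.
have H' : xv / mv <= xw / mw.
  by rewrite ler_pdivrMr // mulrAC ler_pdivlMr.
have v0 : 0 <= xv / mv by rewrite divr_ge0 // ltW.
by apply: ge0_ler_powR; rewrite ?nnegrE ?invr_ge0 ?ler0n // (le_trans v0 H').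
Qed.

Lemma powR_exprnK (R : realType) (c : R) (n : nat) :
  0 <= c -> (c ^+ n.+1) `^ n.+1%:R^-1 = c.
Proof.
by move=> c0; rewrite -powR_mulrn // -powRrM mulfV ?pnatr_eq0 // powRr1.
Qed.

Lemma loss_ge_ratio (R : realType) (n d : nat) (X : 'M[R]_(n, d.+1))
    (p w : 'cV[R]_n) (c : R) :
  0 <= c -> 0 <= psi X p w -> 0 < psi X (popt X w) w ->
  psi X p w <= c ^+ d.+1 * psi X (popt X w) w -> 1 - c <= loss X p w.
Proof.
rewrite /loss; move: (psi X p w) (psi X (popt X w) w) => x m c0 x0 m0 H.
rewrite lerD2l lerN2 -[leRHS](powR_exprnK d c0).
apply: ge0_ler_powR; rewrite ?nnegrE ?invr_ge0 ?ler0n ?exprn_ge0 //.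
  by rewrite divr_ge0 // ltW.
by rewrite ler_pdivrMr.
Qed.

Lemma loss_le_ratio (R : realType) (n d : nat) (X : 'M[R]_(n, d.+1))
    (p w : 'cV[R]_n) (c : R) :
  0 <= c -> 0 <= psi X p w -> 0 < psi X (popt X w) w ->
  c ^+ d.+1 * psi X (popt X w) w <= psi X p w -> loss X p w <= 1 - c.
Proof.
rewrite /loss; move: (psi X p w) (psi X (popt X w) w) => x m c0 x0 m0 H.
rewrite lerD2l lerN2 -[leLHS](powR_exprnK d c0).
apply: ge0_ler_powR; rewrite ?nnegrE ?invr_ge0 ?ler0n ?exprn_ge0 //.
  by rewrite divr_ge0 // ltW.
by rewrite ler_pdivlMr.
Qed.

Lemma psi_ge0 (R : realType) (n d : nat) (X : 'M[R]_(n, d.+1))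
    (p w : 'cV[R]_n) :
  min_supported d p -> (forall i, 0 <= w i ord0) -> 0 <= psi X p w.
Proof.
move=> p_ms w_ge0; have [g g_inj gp] := min_supported_enum p_ms.
have [[p_ge0 _] _] := p_ms.
rewrite (psi_support _ _ g_inj) => [|i]; last by rewrite gp negbK => /eqP.
by rewrite mulr_ge0 ?sqr_ge0 // prodr_ge0 // => k _; rewrite mulr_ge0.
Qed.

Lemma psi_popt_gt0 (R : realType) (n d : nat) (X : 'M[R]_(n, d.+1))
    (f : 'I_d.+1 -> 'I_n) (w : 'cV[R]_n) :
  injective f -> \det (rowsub f X) != 0 -> (forall i, 0 < w i ord0) ->
  0 < psi X (popt X w) w.
Proof.
move=> f_inj f_det w_gt0.
have w_ge0 i : 0 <= w i ord0 by exact: ltW.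
have [_ w_max] := popt_maximizes X f_inj w_ge0.
apply: lt_le_trans (w_max _ (uniform_min_supported R f_inj)).
rewrite psi_uniform // mulr_gt0 ?exprn_gt0 ?invr_gt0 ?ltr0n // mulr_gt0 //.
  by rewrite exprn_even_gt0.
exact: prodr_gt0.
Qed.

Lemma weight_box_gt0 (R : realType) (n : nat) (a b : R) (w : 'cV[R]_n) :
  0 < a -> weight_box a b w -> forall i, 0 < w i ord0.
Proof. by move=> a0 wab i; have /andP[+ _] := wab i; apply: lt_le_trans. Qed.

(** The design weights of [q] and of its competitor cancel from the comparison
    of two losses of [q], so [adverse_weight_prod] decides it for all competitors
    at once. *)
Lemma max_loss_adverse (R : realType) (n d : nat) (X : 'M[R]_(n, d.+1))
    (a b : R) (f g : 'I_d.+1 -> 'I_n) (q : 'cV[R]_n) :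
  0 < a -> a <= b -> injective f -> \det (rowsub f X) != 0 ->
  min_supported d q -> injective g ->
  (forall i, (i \in codom g) = (q i ord0 != 0)) ->
  is_max_loss X (weight_box a b) q (loss X q (adverse_weight a b g)).
Proof.
move=> a0 ab f_inj f_det q_ms g_inj gq.
have v_box := adverse_weight_box g ab.
set v := adverse_weight a b g in v_box *.
split=> [|w w_box]; first by exists v.
have v_gt0 := weight_box_gt0 a0 v_box; have w_gt0 := weight_box_gt0 a0 w_box.
have v_ge0 i : 0 <= v i ord0 by exact: ltW.
have w_ge0 i : 0 <= w i ord0 by exact: ltW.
have Mw := psi_popt_gt0 f_inj f_det w_gt0.
have Mv := psi_popt_gt0 f_inj f_det v_gt0.
apply: (loss_le_cross (psi_ge0 X q_ms v_ge0) Mv Mw).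
have [p_ms _] := popt_maximizes X f_inj w_ge0.
have [_ v_max] := popt_maximizes X f_inj v_ge0.
move: (popt X w) p_ms => p p_ms.
have q_psi : 0 <= psi X q w by exact: psi_ge0.
(* The optimum at v is at least the value there of the design optimal at w. *)
apply: le_trans (ler_wpM2l q_psi (v_max _ p_ms)).
have [h h_inj hp] := min_supported_enum p_ms.
have [[q_ge0 _] _] := q_ms; have [[p_ge0 _] _] := p_ms.
have q0 i : i \notin codom g -> q i ord0 = 0 by rewrite gq negbK => /eqP.
have p0 i : i \notin codom h -> p i ord0 = 0 by rewrite hp negbK => /eqP.
rewrite !(psi_support _ _ g_inj q0) !(psi_support _ _ h_inj p0) !big_split /=.
have := adverse_weight_prod (ltW a0) g_inj h_inj w_box; rewrite -/v.
have : 0 <= \prod_k q (g k) ord0 by rewrite prodr_ge0.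
have : 0 <= \prod_k p (h k) ord0 by rewrite prodr_ge0.
move: (\prod_k q _ _) (\prod_k p _ _) (\prod_k v (g k) _) (\prod_k w (h k) _).
move: (\prod_k w (g k) _) (\prod_k v (h k) _).
have := sqr_ge0 (\det (rowsub g X)); have := sqr_ge0 (\det (rowsub h X)).
move: (_ ^+ 2) (_ ^+ 2) => y z z0 y0 wg vh qg ph vg wh ph0 qg0 H.
have c0 : 0 <= z * qg * (y * ph) by rewrite !mulr_ge0.
by have := ler_wpM2l c0 H; clear; lra.
Qed.

(** The uniform design on [h] sees only the weight [b] where [q] sees only [a];
    its [psi] bounds that of the optimal design from below. *)
Lemma loss_adverse_ge (R : realType) (n d : nat) (X : 'M[R]_(n, d.+1))
    (a b : R) (f g h : 'I_d.+1 -> 'I_n) (q : 'cV[R]_n) :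
  0 < a -> a <= b -> injective f -> \det (rowsub f X) != 0 ->
  min_supported d q -> injective g ->
  (forall i, (i \in codom g) = (q i ord0 != 0)) ->
  injective h -> (forall k, h k \notin codom g) ->
  \det (rowsub g X) ^+ 2 <= \det (rowsub h X) ^+ 2 ->
  1 - a / b <= loss X q (adverse_weight a b g).
Proof.
move=> a0 ab f_inj f_det q_ms g_inj gq h_inj gh gh_det.
have b0 := lt_le_trans a0 ab.
have v_gt0 := weight_box_gt0 a0 (adverse_weight_box g ab).
have v_ge0 i : 0 <= adverse_weight a b g i ord0 by exact: ltW.
have [_ v_max] := popt_maximizes X f_inj v_ge0.
have Mv := psi_popt_gt0 f_inj f_det v_gt0.
have ab_ge0 : 0 <= a / b by rewrite divr_ge0 // ltW.
apply: (loss_ge_ratio ab_ge0 (psi_ge0 X q_ms v_ge0) Mv).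
have c0 : 0 <= (a / b) ^+ d.+1 by exact: exprn_ge0.
apply: le_trans (ler_wpM2l c0 (v_max _ (uniform_min_supported R h_inj))).
have q0 i : i \notin codom g -> q i ord0 = 0 by rewrite gq negbK => /eqP.
have [q_design _] := q_ms.
apply: (le_trans (psi_le_uniform X g_inj q_design q0 v_ge0)).
rewrite !psi_uniform //.
under eq_bigr do rewrite mxE codom_f.
under [X in _ <= _ * (_ * X * _)]eq_bigr => k _ do rewrite mxE (negbTE (gh k)).
rewrite !prodr_const card_ord [X in _ <= X]mulrA.
rewrite ler_wpM2r ?exprn_ge0 ?invr_ge0 ?ler0n //.
rewrite mulrCA -exprMn divfK ?gt_eqF // ler_wpM2r ?exprn_ge0 //.
exact: ltW.
Qed.

(** Both factors of [psi] favour [f] up to the spread of the weights: its minor is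
    maximal, and any two weights differ by a factor of at most [b / a]. *)
Lemma loss_uniform_le (R : realType) (n d : nat) (X : 'M[R]_(n, d.+1))
    (a b : R) (f : 'I_d.+1 -> 'I_n) (w : 'cV[R]_n) :
  0 < a -> a <= b -> max_minor X f -> \det (rowsub f X) != 0 ->
  weight_box a b w -> loss X (uniform_design R f) w <= 1 - a / b.
Proof.
move=> a0 ab [f_inj f_max] f_det w_box.
have b0 := lt_le_trans a0 ab.
have w_gt0 := weight_box_gt0 a0 w_box.
have w_ge0 i : 0 <= w i ord0 by exact: ltW.
have [p_ms _] := popt_maximizes X f_inj w_ge0.
have uf := uniform_min_supported R f_inj.
have Mw := psi_popt_gt0 f_inj f_det w_gt0.
have ab_ge0 : 0 <= a / b by rewrite divr_ge0 // ltW.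
apply: (loss_le_ratio ab_ge0 (psi_ge0 X uf w_ge0) Mw).
have c0 : 0 <= (a / b) ^+ d.+1 by exact: exprn_ge0.
have [h h_inj hp] := min_supported_enum p_ms.
have p0 i : i \notin codom h -> popt X w i ord0 = 0.
  by rewrite hp negbK => /eqP.
have [p_design _] := p_ms.
apply: le_trans (ler_wpM2l c0 (psi_le_uniform X h_inj p_design p0 w_ge0)) _.
rewrite !psi_uniform // [X in X <= _]mulrA.
rewrite ler_wpM2r ?exprn_ge0 ?invr_ge0 ?ler0n //.
have wh : \prod_k w (h k) ord0 <= b ^+ d.+1.
  rewrite -[X in _ ^+ X]card_ord -prodr_const; apply: ler_prod => k _.
  by rewrite w_ge0; case/andP: (w_box (h k)).
have wf : a ^+ d.+1 <= \prod_k w (f k) ord0.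
  rewrite -[X in _ ^+ X]card_ord -prodr_const; apply: ler_prod => k _.
  by rewrite ltW //; case/andP: (w_box (f k)).
have := f_max h h_inj; have := sqr_ge0 (\det (rowsub h X)).
move: (_ ^+ 2) (_ ^+ 2) => y x x0 xy.
rewrite mulrCA.
apply: ler_pM => //; first by rewrite mulr_ge0 // prodr_ge0.
apply: le_trans wf; rewrite expr_div_n mulrAC ler_pdivrMr ?exprn_gt0 //.
by rewrite ler_wpM2l // exprn_ge0 // ltW.
Qed.

(** Since every minimally supported design loses at least [1 - a / b] at its own
    least favourable weights, attaining this value is optimal. *)
Lemma most_robust_uniform (R : realType) (n d : nat)
    (X : 'M[R]_(n, d.+1)) (a b : R) (f : 'I_d.+1 -> 'I_n) :
  0 < a -> a <= b -> max_minor X f -> \det (rowsub f X) != 0 ->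
  (forall g : 'I_d.+1 -> 'I_n, injective g ->
     exists h : 'I_d.+1 -> 'I_n,
       [/\ injective h, forall k, h k \notin codom g &
           \det (rowsub g X) ^+ 2 <= \det (rowsub h X) ^+ 2]) ->
  most_robust X (weight_box a b) (uniform_design R f) /\
  is_max_loss X (weight_box a b) (uniform_design R f) (1 - a / b).
Proof.
move=> a0 ab f_max f_det disj; have [f_inj _] := f_max.
have all_max q : min_supported d q ->
    exists2 s, is_max_loss X (weight_box a b) q s & 1 - a / b <= s.
  move=> q_ms; have [g g_inj gq] := min_supported_enum q_ms.
  have [h [h_inj gh gh_det]] := disj g g_inj.
  exists (loss X q (adverse_weight a b g)).
    exact: max_loss_adverse f_det q_ms g_inj gq.
  exact: loss_adverse_ge f_det q_ms g_inj gq h_inj gh gh_det.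
have uf := uniform_min_supported R f_inj.
have f_loss : is_max_loss X (weight_box a b) (uniform_design R f) (1 - a / b).
  have [s [[w w_box w_s] s_max] s_ge] := all_max _ uf.
  suff -> : 1 - a / b = s by split => //; exists w.
  by apply/eqP; rewrite eq_le s_ge -w_s loss_uniform_le.
by split => //; split => //; exists (1 - a / b).
Qed.

(** * Translating a set of experimental conditions *)

Lemma card_ltn_pairs (m : nat) :
  #|[set p : 'I_m * 'I_m | (p.1 < p.2)%N]%SET| = 'C(m, 2).
Proof.
rewrite -bin2_sum big_mkord -sum1_card.
under eq_bigl do rewrite inE.
rewrite -(pair_big_dep xpredT (fun i j : 'I_m => (i < j)%N) (fun _ _ => 1%N)) /=.
rewrite (exchange_big_dep xpredT) //=; apply: eq_bigr => j _.
rewrite -(big_ord_widen _ (fun _ => 1%N)) ?sum1_card ?card_ord //.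
exact: ltnW.
Qed.

(** In a group of exponent two, the translation by [r] maps [g i] to [g j] only
    if [r] is the difference of [g i] and [g j]. The differences are symmetric,
    and all those with [i = j] coincide, so at most ['C(m, 2) + 1] values of [r] are
    excluded. *)
Lemma disjoint_translate (T : finType) (tau : T -> T -> T) (e : T) (m : nat)
    (g : 'I_m -> T) :
  (forall x y, tau x y = tau y x) -> (forall x, involutive (tau x)) ->
  (forall x, tau x x = e) -> ('C(m, 2).+1 < #|T|)%N ->
  exists r, forall i, tau r (g i) \notin codom g.
Proof.
move=> tauC tauK taue cardT.
pose P := [set p : 'I_m * 'I_m | (p.1 < p.2)%N]%SET.
pose B := (e |: [set tau (g p.1) (g p.2) | p in P])%SET.
have cardB : (#|B| < #|T|)%N.
  apply: leq_ltn_trans cardT; rewrite cardsU1 -add1n leq_add ?leq_b1 //.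
  by rewrite (leq_trans (leq_imset_card _ _)) // card_ltn_pairs.
have [r rB] : exists r, r \notin B.
  apply/existsP; rewrite -negb_forall; apply: contraL cardB => /forallP allB.
  by rewrite -leqNgt; apply/subset_leq_card/fintype.subsetP.
exists r => i; apply: contra rB => /codomP[j tau_ij].
have -> : r = tau (g i) (g j) by rewrite -tau_ij [tau r _]tauC tauK.
rewrite finset.inE finset.in_set1.
have [ij|ji|/val_inj ->] := ltngtP i j; last by rewrite taue eqxx.
- by rewrite (imset_f _ (x := (i, j))) ?orbT // finset.inE.
- by rewrite tauC (imset_f _ (x := (j, i))) ?orbT // finset.inE.
Qed.

Lemma factorial_row_inj (R : realType) (k : nat) (D : 'M[R]_(2 ^ k, k)) i j :
  full_factorial D -> (forall l, D i l = D j l) -> i = j.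
Proof.
move=> [D_sign D_ex] Dij.
have [|m [_ m_uniq]] := D_ex (row i D).
  by move=> l; rewrite mxE; exact: D_sign.
rewrite -(m_uniq i) // -(m_uniq j) //.
by apply/rowP => l; rewrite !mxE Dij.
Qed.

Lemma factorial_sign (R : realType) (k : nat) (D : 'M[R]_(2 ^ k, k)) i l :
  full_factorial D -> D i l * D i l = 1.
Proof.
by case=> /(_ i l)[->|->] _; rewrite ?mulr1 // mulrNN mulr1.
Qed.

(** The entrywise product of sign vectors makes the experimental conditions an
    elementary abelian 2-group; [tau] is its law in terms of row indices. *)
Lemma factorial_translation (R : realType) (k : nat) (D : 'M[R]_(2 ^ k, k)) :
  full_factorial D ->
  exists tau : 'I_(2 ^ k) -> 'I_(2 ^ k) -> 'I_(2 ^ k),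
    [/\ forall r i l, D (tau r i) l = D r l * D i l,
        forall r i, tau r i = tau i r,
        forall r, involutive (tau r) &
        forall r i, tau r r = tau i i].
Proof.
move=> hD; have [D_sign D_ex] := hD.
have ex r : exists t : 'I_(2 ^ k) -> 'I_(2 ^ k),
    forall i l, D (t i) l = D r l * D i l.
  suff /choice[t tP] : forall i, exists j, forall l, D j l = D r l * D i l.
    by exists t.
  move=> i; have [|j [jP _]] := D_ex (\row_l (D r l * D i l)).
    move=> l; rewrite mxE.
    case: (D_sign r l) (D_sign i l) => -> [] ->; rewrite ?mulrNN ?mulr1 ?mul1r; tauto.
  by exists j => l; move: jP => /= /rowP/(_ l); rewrite !mxE.
have [tau tauP] := choice ex; exists tau; split => //.
- by move=> r i; apply: (factorial_row_inj hD) => l; rewrite !tauP mulrC.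
- move=> r i; apply: (factorial_row_inj hD) => l.
  by rewrite !tauP mulrA factorial_sign // mul1r.
- by move=> r i; apply: (factorial_row_inj hD) => l; rewrite !tauP !factorial_sign.
Qed.

(** * The model matrix *)

(** The intercept is the character of the empty set of factors, so the columns
    of the model matrix are pairwise distinct characters of the group of
    experimental conditions. *)
Lemma model_matrix_characters (R : realType) (k d : nat)
    (D : 'M[R]_(2 ^ k, k)) (X : 'M[R]_(2 ^ k, d.+1)) :
  model_matrix D X ->
  exists2 S : 'I_d.+1 -> {set 'I_k}, injective S &
    forall i j, X i j = \prod_(l in S j) D i l.
Proof.
case=> S [S_inj S_n0 _ X0 XS].
exists (fun j => oapp S finset.set0 (unlift ord0 j)).
- move=> i j; case: (unliftP ord0 i) => [i'|] ->; case: (unliftP ord0 j) => [j'|] -> //=.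
  + by move/S_inj->.
  + by move=> Si; move: (S_n0 i'); rewrite Si eqxx.
  + by move=> Sj; move: (S_n0 j'); rewrite -Sj eqxx.
- move=> i j; case: (unliftP ord0 j) => [j'|] -> /=; first exact: XS.
  by rewrite big_set0 X0.
Qed.

Lemma model_matrix_translation (R : realType) (k d : nat)
    (D : 'M[R]_(2 ^ k, k)) (X : 'M[R]_(2 ^ k, d.+1)) r i t j :
  model_matrix D X -> (forall l, D t l = D r l * D i l) ->
  X t j = X r j * X i j.
Proof.
move=> /model_matrix_characters[S _ XS] Dt; rewrite !XS -big_split /=.
by apply: eq_bigr.
Qed.

Lemma model_matrix_sign (R : realType) (k d : nat)
    (D : 'M[R]_(2 ^ k, k)) (X : 'M[R]_(2 ^ k, d.+1)) i j :
  full_factorial D -> model_matrix D X -> X i j * X i j = 1.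
Proof.
move=> hD /model_matrix_characters[S _ XS]; rewrite XS -big_split /=.
by apply: big1 => l _; exact: factorial_sign.
Qed.

(** Translating the rows by [r] multiplies the columns of the submatrix by the
    signs in row [r]. *)
Lemma minor_translation (R : realType) (k d : nat)
    (D : 'M[R]_(2 ^ k, k)) (X : 'M[R]_(2 ^ k, d.+1)) r
    (t : 'I_(2 ^ k) -> 'I_(2 ^ k)) (g : 'I_d.+1 -> 'I_(2 ^ k)) :
  full_factorial D -> model_matrix D X ->
  (forall i l, D (t i) l = D r l * D i l) ->
  \det (rowsub (t \o g) X) ^+ 2 = \det (rowsub g X) ^+ 2.
Proof.
move=> hD hX Dt.
have -> : rowsub (t \o g) X = rowsub g X *m diag_mx (row r X).
  apply/matrixP => i j; rewrite mul_mx_diag !mxE mulrC.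
  exact: model_matrix_translation hX (Dt _).
rewrite det_mulmx det_diag exprMn -[RHS]mulr1; congr (_ * _).
rewrite expr2 -big_split /=; apply: big1 => j _.
by rewrite mxE (model_matrix_sign _ _ hD hX).
Qed.

(** Two distinct characters take different values at some condition: flip a
    single factor that occurs in one of the two sets only. *)
Lemma model_matrix_separates (R : realType) (k d : nat)
    (D : 'M[R]_(2 ^ k, k)) (X : 'M[R]_(2 ^ k, d.+1)) u v :
  full_factorial D -> model_matrix D X -> u != v ->
  exists r, X r u * X r v = -1.
Proof.
move=> [_ D_ex] /model_matrix_characters[S S_inj XS] uv.
have [l luv] : exists l, (l \in S u) != (l \in S v).
  apply/existsP; rewrite -negb_forall; apply: contra uv => /forallP Suv.
  by apply/eqP/S_inj/setP => l; apply/eqP.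
have [|r [rP _]] := D_ex (\row_m (if m == l then -1 else 1)).
  by move=> m; rewrite mxE; case: ifP; tauto.
have Dr m : D r m = if m == l then -1 else 1 
  by move: rP => /= /rowP/(_ m); rewrite !mxE.
have Xr j : X r j = if l \in S j then -1 else 1.
  rewrite XS; under eq_bigr do rewrite Dr.
  rewrite -big_mkcondr /=; case: ifP => lS.
    by rewrite (big_pred1 l) // => m /=; case: eqP => [->|]; rewrite ?lS ?andbF.
  by rewrite big_pred0 // => m; case: eqP => [->|]; rewrite ?lS ?andbF.
exists r; rewrite !Xr; move: luv.
by case: (l \in S u); case: (l \in S v) => // _; rewrite ?mulr1 ?mul1r.
Qed.

(** A translation permutes the rows and negates the inner product of two columns
    that it separates, so distinct columns are orthogonal. *)
Lemma model_matrix_gram (R : realType) (k d : nat)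
    (D : 'M[R]_(2 ^ k, k)) (X : 'M[R]_(2 ^ k, d.+1)) :
  full_factorial D -> model_matrix D X -> X^T *m X = (2 ^ k)%:R%:M.
Proof.
move=> hD hX; have [tau [tauP _ tauK _]] := factorial_translation hD.
apply/matrixP => u v; rewrite !mxE.
under eq_bigr do rewrite mxE.
case: eqVneq => [<-|uv].
  under eq_bigr do rewrite (model_matrix_sign _ _ hD hX).
  by rewrite sumr_const card_ord.
have [r Xr] := model_matrix_separates hD hX uv.
set s := \sum_i _; suff : s = - s by move=> ss; rewrite mulr0n; lra.
rewrite {1}/s (reindex_inj (inv_inj (tauK r))) /= -sumrN.
apply: eq_bigr => i _.
by rewrite !(model_matrix_translation _ hX (tauP r i)) mulrACA Xr mulN1r.
Qed.

Lemma max_minor_neq0 (R : realType) (k d : nat)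
    (D : 'M[R]_(2 ^ k, k)) (X : 'M[R]_(2 ^ k, d.+1))
    (f : 'I_d.+1 -> 'I_(2 ^ k)) :
  full_factorial D -> model_matrix D X -> max_minor X f ->
  \det (rowsub f X) != 0.
Proof.
move=> hD hX [_ f_max].
have X_full : row_full X.
  rewrite -col_leq_rank -[X in (X <= _)%N](@mxrank_unit _ _ (X^T *m X)).
    exact: mxrankM_maxr.
  rewrite (model_matrix_gram hD hX) unitmxE det_scalar unitfE expf_eq0 /=.
  by rewrite pnatr_eq0 expn_eq0.
have h_inj : injective (fullrankfun X_full) by exact: fullrankfun_inj.
have := f_max _ h_inj.
apply: contraTneq => ->; rewrite expr0n /= -ltNge exprn_even_gt0 //=.
by have := fullrowsub_unit X_full; rewrite unitmxE unitfE.
Qed.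

(** * The most robust design *)

Theorem theorem5p1p6 (R : realType) (k d : nat)
    (hk : (3 <= k)%N) (hkd : (k <= d)%N)
    (hd : (d * d.+1 <= 2 ^ k.+1 - 4)%N)
    (D : 'M[R]_(2 ^ k, k)) (hD : full_factorial D)
    (X : 'M[R]_(2 ^ k, d.+1)) (hX : model_matrix D X)
    (a b : R) (ha : 0 < a) (hab : a < b)
    (f : 'I_d.+1 -> 'I_(2 ^ k)) (hf : max_minor X f) :
  most_robust X (weight_box a b) (uniform_design R f) /\
  is_max_loss X (weight_box a b) (uniform_design R f) (1 - a / b).
Proof.
apply: most_robust_uniform (ltW hab) hf (max_minor_neq0 hD hX hf) _ => //.
move=> g g_inj; have [tau [tauP tauC tauK tau_diag]] := factorial_translation hD.
have card_bound : ('C(d.+1, 2).+1 < #|'I_(2 ^ k)|)%N.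
  rewrite card_ord bin2 /=.
  (* Half of hd says that there are at most 2 ^ k - 2 unordered pairs. *)
  have := half_leq hd; rewrite expnS mul2n -[4%N]/(2.*2)%N -doubleB doubleK.
  have : (2 ^ 3 <= 2 ^ k)%N by rewrite leq_exp2l.
  rewrite mulnC; move: (_./2) (2 ^ k)%N => x y; lia.
have [r r_disj] := disjoint_translate g tauC tauK (tau_diag^~ (f ord0)) card_bound.
exists (tau r \o g); split => //.
  exact: inj_comp (inv_inj (tauK r)) g_inj.
by rewrite (minor_translation g hD hX (tauP r)).
Qed.
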